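(* There is an infinite sequence of integers $r$ for which there are $\exp(r^{0.5-o(1)})$ pairwise non-isomorphic minimal intersecting $r$-Ryser hypergraphs.
   Context: A hypergraph is a family of subsets (edges) of a vertex set. It is $r$-uniform if every edge has $r$ vertices. It is $r$-partite if its vertex set can be partitioned into $r$ sets (sides) so that every edge contains at most one vertex from each side. A cover is a set of vertices meeting every edge; $\tau(\mathcal H)$ is the minimum size of a cover. $\nu(\mathcal H)$ is the maximum number of pairwise disjoint edges; $\mathcal H$ is intersecting if $\nu(\mathcal H)=1$. An $r$-Ryser hypergraph is an $r$-partite $r$-uniform hypergraph $\mathcal H$ with $\tau(\mathcal H)=(r-1)\nu(\mathcal H)$. An intersecting $r$-Ryser hypergraph is minimal if the deletion of any edge produces a hypergraph with cover number $r-2$. Two hypergraphs are isomorphic if there is a bijection between their vertex sets mapping edge set onto edge set; isolated vertices (vertices in no edge) are disregarded when deciding isomorphism. The term $o(1)$ tends to $0$ as $r\to\infty$ along the sequence. *)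

(* Defs.v *)
From mathcomp Require Import all_boot all_order all_algebra.

Set Implicit Arguments.
Unset Strict Implicit.
Unset Printing Implicit Defensive.

Import Order.TTheory GRing.Theory Num.Theory.

Local Open Scope ring_scope.

Record hypergraph := Hypergraph {
  vertices : finType;
  edges : {set {set vertices}}
}.

Definition uniform (r : nat) (H : hypergraph) : Prop :=
  forall e, e \in edges H -> #|e| = r.

(* The r sides of the partition are the fibres of the map [side]. *)
Definition partite (r : nat) (H : hypergraph) : Prop :=
  exists side : vertices H -> 'I_r,
    forall e, e \in edges H ->
    forall s : 'I_r, (#|[set x in e | side x == s]| <= 1)%N.

Definition is_cover (H : hypergraph) (C : {set vertices H}) : bool :=
  [forall e in edges H, ~~ [disjoint e & C]].

(* [setT] is a cover unless the empty set is an edge, in which case there is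
   no cover at all and tau takes the junk value #|vertices H|. *)
Definition tau (H : hypergraph) : nat :=
  #|[arg min_(C < [set: vertices H] | is_cover C) #|C|]|.

Definition nu (H : hypergraph) : nat :=
  \max_(M : {set {set vertices H}} | (M \subset edges H) && trivIset M) #|M|.

Definition intersecting (H : hypergraph) : Prop := nu H = 1%N.

(* The subtractions r - 1 and r - 2 are taken in int, so they are not
   truncated. *)
Definition ryser (r : nat) (H : hypergraph) : Prop :=
  [/\ partite r H, uniform r H & (tau H)%:Z = (r%:Z - 1) * (nu H)%:Z].

Definition delete_edge (H : hypergraph) (e : {set vertices H}) : hypergraph :=
  Hypergraph (edges H :\ e).

Definition minimal_intersecting_ryser (r : nat) (H : hypergraph) : Prop :=
  [/\ ryser r H, intersecting H &
    forall e, e \in edges H -> (tau (delete_edge e))%:Z = r%:Z - 2].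

(* [cover E] is the union of the members of E, so the vertices kept are
   exactly the non-isolated ones. *)
Definition remove_isolated (H : hypergraph) : hypergraph :=
  @Hypergraph {x : vertices H | x \in cover (edges H)}
    [set A : {set _} | [set val x | x in A] \in edges H].

Definition isomorphic (H1 H2 : hypergraph) : Prop :=
  exists f : vertices (remove_isolated H1) -> vertices (remove_isolated H2),
    bijective f /\
    [set [set f x | x in e] | e : {set _} in edges (remove_isolated H1)]
      = edges (remove_isolated H2).

(* Main.v *)
(** Let F be a field with q = s^2 elements, s = 2^(k+1), and r = q + 2.  Identify
    the affine plane F^2 with the monic quadratics, (x, y) being t^2 - x t + y,
    and let A be the set of split ones.  The line y = a x - a^2 consists of the
    quadratics vanishing at a, so these q lines, one of each finite slope, lie
    in A; a family of fewer than q lines omits one of them and meets it in fewer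
    than q points, so it does not cover A.
    The edges of the hypergraph are the points of F^2 and one extra point z_d
    for each direction d; the sides are the q + 1 directions and one more side,
    at infinity, and the vertices of a side are the cells of a partition of the
    edges.  In its direction a point lies in the cell of its line; z_d is
    attached to one line of each direction other than d, chosen so that these q
    lines cover A (replace y = a x - a^2 by x = 2 a when d is the slope a), and
    is alone in direction d.  At infinity, F^2 \ A and the z_d form one cell and
    the points of A are alone.  A cover by q cells that avoids the large cell at
    infinity would contain a parallel class and miss the corresponding z_d; one
    that uses it would cover A by q - 1 lines.  So the cover number is q + 1.
    Each point of the row y = 0 can be avoided by some q cells covering all
    the rest, hence belongs to every critical subfamily.  Merging the cells at
    infinity of these q points in an arbitrary way changes neither the cover
    number nor criticality, because a merged cell is contained in the cell of
    the row.  The sizes of the merged cells can be read off from the degrees, so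
    we obtain as many non-isomorphic hypergraphs as there are partitions of q,
    of which we use 2^(s-1). *)

Require Import Defs.
From HB Require Import structures.
From mathcomp Require Import all_boot all_order all_algebra.
From mathcomp Require Import all_classical all_reals all_analysis.
From mathcomp Require Import finfield ring lra.
(* Imported last: all_classical shadows setT, set0 and subsetP. *)
From mathcomp Require Import fintype finset.

Set Implicit Arguments.
Unset Strict Implicit.
Unset Printing Implicit Defensive.

Import Order.TTheory GRing.Theory Num.Theory.
Import numFieldNormedType.Exports.

(** * Degree counts as isomorphism invariants *)

Definition degree (H : hypergraph) (v : vertices H) : nat :=
  #|[set e in edges H | v \in e]|.

Definition degree_count (H : hypergraph) (j : nat) : nat :=
  #|[set v : vertices H | degree v == j]|.

Lemma degree_remove_isolated (H : hypergraph)
    (x : vertices (remove_isolated H)) :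
  degree x = degree (val x).
Proof.
have inj_val : injective (fun A : {set vertices (remove_isolated H)} =>
    [set val y | y in A]) by apply: imset_inj; exact: val_inj.
rewrite /degree -(card_imset _ inj_val); apply: eq_card => e.
apply/imsetP/idP => [[A]|].
  by rewrite !inE => /andP[HA xA] ->; rewrite HA imset_f.
rewrite !inE => /andP[He xe].
have eE : [set val y | y in
    [set y : vertices (remove_isolated H) | val y \in e]] = e.
  apply/setP => v; apply/imsetP/idP => [[y]|ve]; first by rewrite inE => ? ->.
  have cv : v \in finset.cover (edges H) by apply/bigcupP; exists e.
  by exists (Sub v cv); rewrite ?inE SubK.
by exists [set y | val y \in e]; rewrite ?inE eE ?He.
Qed.

(** Dropped vertices have degree 0, so only the count for [j = 0] can change. *)
Lemma degree_count_remove_isolated (H : hypergraph) (j : nat) :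
  0 < j -> degree_count (remove_isolated H) j = degree_count H j.
Proof.
move=> j_gt0; rewrite /degree_count -(card_imset _ val_inj).
apply: eq_card => v; apply/imsetP/idP => [[x]|].
  by rewrite !inE degree_remove_isolated => dx ->.
rewrite inE => dv.
have : 0 < degree v by rewrite (eqP dv).
case/card_gt0P => e; rewrite inE => /andP[He ve].
have cv : v \in finset.cover (edges H) by apply/bigcupP; exists e.
by exists (Sub v cv); rewrite ?inE ?degree_remove_isolated SubK.
Qed.

Lemma isomorphic_degree_count (H1 H2 : hypergraph) (j : nat) :
  isomorphic H1 H2 -> 0 < j -> degree_count H1 j = degree_count H2 j.
Proof.
move=> [f [bij_f f_edges]] j_gt0; have inj_f := bij_inj bij_f.
rewrite -(degree_count_remove_isolated H1) //.
rewrite -(degree_count_remove_isolated H2) //.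
have deg_f x : degree (f x) = degree x.
  rewrite /degree -f_edges -[RHS](card_imset _ (imset_inj inj_f)).
  apply: eq_card => e; apply/setIdP/imsetP => [[/imsetP[e1 He1 ->]]|[e1]].
    by rewrite (mem_imset _ _ inj_f) => xe1; exists e1; [apply/setIdP|].
  by move=> /setIdP[He1 xe1] ->; rewrite !imset_f.
rewrite /degree_count -(card_imset _ inj_f); apply: eq_card => v.
have [g _ gK] := bij_f; rewrite -[v]gK (mem_imset _ _ inj_f) !inE deg_f //.
Qed.

(** * Hypergraphs given by labellings *)

Section Labelled.

Variables (I P W : finType).
Implicit Types (f : I -> P -> W) (T : {set P}) (C : {set I * W}).

(** The edge is the graph of [f ^~ p], one vertex per side, which makes the hypergraph partite and
    uniform by construction. *)
Definition point_edge (f : I -> P -> W) (p : P) : {set I * W} :=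
  [set v | f v.1 p == v.2].

Definition labelled_hypergraph (f : I -> P -> W) (T : {set P}) :=
  Hypergraph [set point_edge f p | p in T].

Definition pierces (f : I -> P -> W) (T : {set P}) (C : {set I * W}) : bool :=
  [forall p in T, [exists v in C, f v.1 p == v.2]].

Lemma piercesP f T C :
  reflect (forall p, p \in T -> exists2 v, v \in C & f v.1 p = v.2)
          (pierces f T C).
Proof.
apply: (iffP forall_inP) => pC p /pC.
  by case/exists_inP=> v vC /eqP; exists v.
by case=> v vC E; apply/exists_inP; exists v; rewrite ?E.
Qed.

Lemma is_cover_labelled f T (C : {set I * W}) :
  @is_cover (labelled_hypergraph f T) C = pierces f T C.
Proof.
apply/forall_inP/piercesP => [cC p pT|pC e /imsetP[p pT ->]].
  have /pred0Pn[v /=] := cC _ (imset_f (point_edge f) pT).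
  by rewrite inE => /andP[/eqP fv vC]; exists v.
have [v vC fv] := pC p pT.
by apply/pred0Pn; exists v; rewrite /= vC inE fv eqxx.
Qed.

Lemma pierces_imset f f' T C (phi : I * W -> I * W) :
  (forall p v, f v.1 p = v.2 -> f' (phi v).1 p = (phi v).2) ->
  pierces f T C -> pierces f' T (phi @: C).
Proof.
move=> phiP /piercesP pC; apply/piercesP => p /pC[v vC fv].
by exists (phi v); rewrite ?imset_f //; apply: phiP.
Qed.

Lemma pierces_setT (i : I) f T : pierces f T setT.
Proof. by apply/piercesP => p _; exists (i, f i p). Qed.

Lemma tau_labelled_leP (i : I) f T n :
  reflect (exists2 C, pierces f T C & #|C| <= n)
          (tau (labelled_hypergraph f T) <= n).
Proof.
rewrite /tau; case: arg_minnP => [|C cC minC].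
  by rewrite is_cover_labelled pierces_setT.
apply: (iffP idP) => [leCn|[D pD leDn]].
  by exists C; rewrite // -is_cover_labelled.
by apply: leq_trans leDn; apply: minC; rewrite is_cover_labelled.
Qed.

Lemma card_point_edge f p : #|point_edge f p| = #|I|.
Proof.
have inj_p : injective (fun i => (i, f i p)) by move=> i j [].
rewrite -(card_imset _ inj_p); apply: eq_card => -[i w].
rewrite !inE /=; apply/eqP/imsetP => [<-|[j _ [-> ->]] //].
by exists i.
Qed.

Lemma partite_labelled f T : partite #|I| (labelled_hypergraph f T).
Proof.
exists (fun v => enum_rank v.1) => e /imsetP[p _ ->] s.
apply/card_le1_eqP => -[i w] [j u]; rewrite !inE /=.
move=> /andP[/eqP <- /eqP <-] /andP[/eqP <- /eqP].
by move/enum_rank_inj->.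
Qed.

Lemma intersecting_labelled f T :
  (forall p p', exists i, f i p = f i p') -> injective (point_edge f) ->
  0 < #|I| -> T != set0 -> intersecting (labelled_hypergraph f T).
Proof.
move=> agree inj_f I_gt0 /set0Pn[p0 p0T]; apply/eqP; rewrite eqn_leq.
apply/andP; split.
  apply/bigmax_leqP => M /andP[/subsetP sM /trivIsetP tM].
  apply/card_le1_eqP => e2 e1 M2 M1; apply/eqP/negPn/negP => ne12.
  have := tM _ _ M1 M2 ne12.
  have /imsetP[p1 _ E1] := sM _ M1; have /imsetP[p2 _ E2] := sM _ M2.
  have [i fi] := agree p1 p2.
  case/pred0P/(_ (i, f i p1)); rewrite /= E1 E2 !inE fi eqxx //.
pose M : {set {set I * W}} := [set point_edge f p0].
apply: (@leq_trans #|M|); first by rewrite cards1.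
apply: (@leq_bigmax_cond _ _ (fun M : {set {set I * W}} => #|M|)).
rewrite sub1set imset_f //=; apply/trivIsetP => A B.
by rewrite !inE => /eqP-> /eqP->; rewrite eqxx.
Qed.

Lemma delete_edge_labelled f T p : injective (point_edge f) ->
  @delete_edge (labelled_hypergraph f T) (point_edge f p) =
  labelled_hypergraph f (T :\ p).
Proof.
move=> inj_f; congr (@Hypergraph _ _); apply/setP => e; rewrite /= !inE.
apply/andP/imsetP => [[ne /imsetP[p' p'T eE]]|[p' /setD1P[ne p'T] ->]].
  exists p' => //; rewrite !inE p'T andbT.
  by apply: contraNneq ne => <-; rewrite eE.
by rewrite inj_eq // imset_f.
Qed.

Lemma degree_labelled f T v : injective (point_edge f) ->
  @degree (labelled_hypergraph f T) v = #|[set p in T | f v.1 p == v.2]|.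
Proof.
move=> inj_f; rewrite /degree -(card_imset _ inj_f); apply: eq_card => e.
rewrite !inE; apply/andP/imsetP => [[/imsetP[p pT ->]]|[p]].
  by rewrite inE => fp; exists p; rewrite // inE pT.
by rewrite inE => /andP[pT fp] ->; rewrite imset_f // inE.
Qed.

(** Adding one vertex of [p] to a cover of [T :\ p] covers [T]. Hence [tau] is exactly [q + 1] on
    [T] and exactly [q] after any deletion. *)
Lemma minimal_ryser_labelled f T q :
  #|I| = q.+2 -> (forall p p', exists i, f i p = f i p') ->
  injective (point_edge f) -> T != set0 ->
  (forall C, pierces f T C -> q < #|C|) ->
  (forall p, p \in T -> exists2 C, pierces f (T :\ p) C & #|C| <= q) ->
  minimal_intersecting_ryser q.+2 (labelled_hypergraph f T).
Proof.
move=> cardI agree inj_f T_n0 tau_gt tau_del.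
have [i _] : exists i : I, true by apply/card_gt0P; rewrite cardI.
have tauT : q < tau (labelled_hypergraph f T).
  rewrite ltnNge; apply/negP => /(tau_labelled_leP i)[C /tau_gt].
  by rewrite ltnNge => /negP.
have extend p C : p \in T -> pierces f (T :\ p) C ->
    pierces f T ((i, f i p) |: C).
  move=> pT /piercesP pC; apply/piercesP => p' p'T.
  have [->|ne] := eqVneq p' p; first by exists (i, f i p); rewrite // setU11.
  have [|v vC fv] := pC p'; first by rewrite !inE ne.
  by exists v; rewrite // setU1r.
have leCU p C : #|(i, f i p) |: C| <= #|C|.+1.
  by rewrite cardsU1 -add1n leq_add2r leq_b1.
have nu1 : intersecting (labelled_hypergraph f T).
  by apply: intersecting_labelled; rewrite // cardI.
split=> //.
- split; first by rewrite -cardI; exact: partite_labelled.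
    by move=> e /imsetP[p _ ->]; rewrite card_point_edge.
  suff -> : tau (labelled_hypergraph f T) = q.+1.
    by rewrite nu1 mulr1 -[q.+2]addn1 PoszD addrK.
  apply/eqP; rewrite eqn_leq tauT andbT; apply/(tau_labelled_leP i).
  have [p pT] := set0Pn _ T_n0; have [C pC leC] := tau_del p pT.
  exists ((i, f i p) |: C); first exact: extend.
  exact: leq_trans (leCU p C) _.
- move=> e /imsetP[p pT ->]; rewrite delete_edge_labelled //.
  suff -> : tau (labelled_hypergraph f (T :\ p)) = q.
    by rewrite -[q.+2]addn2 PoszD addrK.
  apply/eqP; rewrite eqn_leq; apply/andP; split.
    exact/(tau_labelled_leP i)/tau_del.
  rewrite leqNgt; apply/negP => lt_q.
  have /(tau_labelled_leP i)[C pC leC] :=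
    leqnn (tau (labelled_hypergraph f (T :\ p))).
  have := leq_trans (tau_gt _ (extend p C pT pC)) (leCU p C).
  by rewrite ltnS leqNgt (leq_ltn_trans leC lt_q).
Qed.

(** [T] is inclusion-minimal among the families that no [q] cells pierce. *)
Lemma exists_critical f q : (forall C, pierces f setT C -> q < #|C|) ->
  exists T, (forall C, pierces f T C -> q < #|C|) /\
    forall p, p \in T -> exists2 C, pierces f (T :\ p) C & #|C| <= q.
Proof.
move=> tau_gt.
pose big (T : {set P}) := [forall C, pierces f T C ==> (q < #|C|)].
have bigP T : reflect (forall C, pierces f T C -> q < #|C|) (big T).
  by apply: (iffP forallP) => [h C|h C]; [apply/implyP|apply/implyP; apply: h].
have [T /minsetP[/bigP bT minT] _] := minset_exists (introT (bigP setT) tau_gt).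
exists T; split=> // p pT.
have : ~~ big (T :\ p).
  apply/negP => bTp; have := minT _ bTp (subD1set T p).
  by move/setP/(_ p); rewrite !inE eqxx pT.
rewrite negb_forall => /existsP[C]; rewrite negb_imply -leqNgt => /andP[pC leC].
by exists C.
Qed.

End Labelled.

(** * The hypergraph of an affine plane *)

Section Plane.

Variable F : finFieldType.
Local Open Scope ring_scope.
Local Notation cell := (option (option F) * option (F * F))%type.

Definition line_label (d : option F) (e : F * F) : F :=
  if d is Some s then e.2 - s * e.1 else e.1.

Definition splits (e : F * F) : bool :=
  [exists u, [exists v, e == (u + v, u * v)]].

(* [tangent_label c d] is the line of direction [d] to which z_c is attached
   (junk for [d = c]). *)
Definition tangent_label (c d : option F) : F :=
  match d with
  | Some b => - (b * b)
  | None => if c is Some a then a + a else 0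
  end.

(* [None] as a side is the side at infinity.  [g] says how the cells at infinity
   of the points of the row y = 0 are merged; [g = id] means no merging. *)
Definition plane_label (g : F -> F) (i : option (option F))
    (p : F * F + option F) : option (F * F) :=
  match i, p with
  | Some d, inl e => Some (line_label d e, 0)
  | Some d, inr c => if d == c then None else Some (tangent_label c d, 0)
  | None, inl e =>
      if splits e then Some (if e.2 == 0 then (g e.1, 0) else e) else None
  | None, inr _ => None
  end.

Lemma splitsP e : reflect (exists u v, e = (u + v, u * v)) (splits e).
Proof.
apply: (iffP existsP) => [[u /existsP[v /eqP->]]|[u [v ->]]].
  by exists u, v.
by exists u; apply/existsP; exists v.
Qed.

Lemma splits_axis a : splits (a, 0).
Proof. by apply/splitsP; exists a, 0; rewrite addr0 mulr0. Qed.

Lemma line_label_agree e e' : exists d, line_label d e = line_label d e'.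
Proof.
have [eq1|ne1] := eqVneq e.1 e'.1; first by exists None.
exists (Some ((e.2 - e'.2) / (e.1 - e'.1))) => /=.
have ne : e.1 - e'.1 != 0 by rewrite subr_eq0.
by field.
Qed.

Lemma line_label_inj d d' e e' : d != d' ->
  line_label d e = line_label d e' -> line_label d' e = line_label d' e' ->
  e = e'.
Proof.
case: e e' => [x y] [x' y'].
have slope s s' : s != s' -> y - s * x = y' - s * x' ->
    y - s' * x = y' - s' * x' -> (x, y) = (x', y').
  move=> ne E E'; have xx : x = x'.
    apply/eqP; rewrite -subr_eq0.
    have : (s - s') * (x - x') = 0.
      have -> : (s - s') * (x - x') =
        (y - s' * x - (y' - s' * x')) - (y - s * x - (y' - s * x')) by ring.
      by rewrite E E' !subrr.
    by move/eqP; rewrite mulf_eq0 (subr_eq0 s) (negPf ne).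
  by move: E; rewrite xx => /addIr ->.
case: d d' => [s|] [s'|] //= ne E E'.
- by apply: (slope s s') => //; apply: contraNneq ne => ->.
- by rewrite E' in E *; move: E => /addIr ->.
- by rewrite E in E' *; move: E' => /addIr ->.
Qed.

Lemma line_label_tangent u v : line_label (Some u) (u + v, u * v) = - (u * u).
Proof. by rewrite /=; ring. Qed.

(** The quadratic with roots [u], [v] lies on the tangents at [u] and at [v]. Both are excluded only
    if u = v is the slope [c], and then the vertical line x = 2 u replaces them. *)
Lemma tangent_label_split c u v :
  exists2 d, d != c & line_label d (u + v, u * v) = tangent_label c d.
Proof.
have [cu|ncu] := eqVneq (Some u) c; last first.
  by exists (Some u) => //; rewrite line_label_tangent.
have [uv|nuv] := eqVneq v u; first by exists None; rewrite -cu // uv.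
exists (Some v); last by rewrite addrC mulrC line_label_tangent.
by rewrite -cu; apply: contraNneq nuv => -[->].
Qed.

Lemma plane_label_agree g p p' :
  exists i, plane_label g i p = plane_label g i p'.
Proof.
(* A non-split point shares the large cell at infinity with z_c, a split one shares a line attached
   to z_c. *)
have mixed e c : exists i, plane_label g i (inl e) = plane_label g i (inr c).
  have [|ns] := boolP (splits e); last by exists None; rewrite /= (negPf ns).
  case/splitsP=> u [v ->]; have [d dc E] := tangent_label_split c u v.
  by exists (Some d); rewrite /plane_label E (negPf dc).
case: p p' => [e|c] [e'|c'].
- have [d E] := line_label_agree e e'.
  by exists (Some d); rewrite /plane_label E.
- exact: mixed.
- by have [i E] := mixed e' c; exists i.
- by exists None.
Qed.

Lemma point_edge_plane_inj g : injective (point_edge (plane_label g)).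
Proof.
move=> p p' E.
have lab i : plane_label g i p = plane_label g i p'.
  have : (i, plane_label g i p) \in point_edge (plane_label g) p.
    by rewrite inE /=.
  by rewrite E inE => /eqP.
case: p p' {E} lab => [[x y]|c] [[x' y']|c'] lab.
- have := lab (Some None); have := lab (Some (Some 0)) => /=.
  by rewrite !mul0r !subr0 => -[->] [->].
- by have := lab (Some c'); rewrite /= eqxx.
- by have := lab (Some c); rewrite /= eqxx.
- by have := lab (Some c) => /=; rewrite eqxx; case: eqP => // ->.
Qed.

(** * Covers of the plane hypergraph *)

Definition line_point (d : option F) (t a : F) : F * F :=
  if d is Some s then (a, t + s * a) else (t, a).

Lemma line_label_point d t a : line_label d (line_point d t a) = t.
Proof. by case: d => [s|] //=; rewrite addrK. Qed.

Lemma line_point_inj d t : injective (line_point d t).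
Proof. by case: d => [s|] a b []. Qed.

(** Lines of other directions meet the given line once, and for [g = id] the cells at infinity other
    than the large one are single points. *)
Lemma plane_label_id_linear d e e' v :
  v != (Some d, Some (line_label d e, 0)) ->
  v != (None, None) ->
  line_label d e = line_label d e' ->
  plane_label id v.1 (inl e) = v.2 -> plane_label id v.1 (inl e') = v.2 ->
  e = e'.
Proof.
case: v => -[d'|] w /=.
  move=> ne _ E Ew E'; have [dd|dd] := eqVneq d d'.
    by case/eqP: ne; rewrite -Ew dd.
  by apply: (line_label_inj dd E); move: E'; rewrite -Ew => -[].
have axis (x : F * F) : (if x.2 == 0 then (x.1, 0) else x) = x.
  by case: x => x1 x2 /=; case: eqP => [->|].
rewrite !axis => _ ne _ Ew E'; case: ifP Ew => _ Ew.
  by move: E'; rewrite -Ew; case: ifP => // _ [].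
by rewrite -Ew eqxx in ne.
Qed.

Lemma injective_cover_of_line (d : option F) t (C : {set cell}) :
  (Some d, Some (t, 0)) \notin C -> (None, None) \notin C ->
  (forall a, exists2 v, v \in C &
     plane_label id v.1 (inl (line_point d t a)) = v.2) ->
  exists2 m : F -> cell, injective m & forall a, m a \in C /\
     plane_label id (m a).1 (inl (line_point d t a)) = (m a).2.
Proof.
move=> LC NC H.
have {}H a : exists v, (v \in C) &&
    (plane_label id v.1 (inl (line_point d t a)) == v.2).
  by have [v vC E] := H a; exists v; rewrite vC E eqxx.
pose m a := xchoose (H a).
have mP a : m a \in C /\
    plane_label id (m a).1 (inl (line_point d t a)) = (m a).2.
  by have /andP[? /eqP] := xchooseP (H a).
exists m => // a b mab; have [maC Ea] := mP a; have [_ Eb] := mP b.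
rewrite -mab in Eb; apply: (@line_point_inj d t).
apply: (@plane_label_id_linear d _ _ _ _ _ _ Ea Eb).
- by rewrite line_label_point; apply: contraNneq LC => <-.
- by apply: contraNneq NC => <-.
- by rewrite !line_label_point.
Qed.

Lemma card_cover_split_ge (C : {set cell}) :
  (None, None) \notin C ->
  (forall u v, exists2 w, w \in C &
     plane_label id w.1 (inl (u + v, u * v)) = w.2) -> (#|F| <= #|C|)%N.
Proof.
move=> NC H.
pose tangent (u : F) : cell := (Some (Some u), Some (- (u * u), 0)).
have [/forallP all_in|/forallPn[u LC]] := boolP [forall u, tangent u \in C].
  have inj_t : injective tangent by move=> u v [].
  rewrite -(card_imset _ inj_t); apply: subset_leq_card.
  by apply/subsetP => w /imsetP[u _ ->].
have [|m inj_m mC] := injective_cover_of_line LC NC.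
  (* The point with abscissa [a] on the tangent at [u] splits with roots [u] and [a - u]. *)
  move=> a; have [w wC E] := H u (a - u); exists w => //.
  by rewrite -{}E /=; congr (plane_label _ _ (inl (_, _))); ring.
rewrite -(card_imset _ inj_m); apply: subset_leq_card.
by apply/subsetP => w /imsetP[a _ ->]; case: (mC a).
Qed.

Lemma card_cover_plane_gt C :
  pierces (plane_label id) setT C -> (#|F| < #|C|)%N.
Proof.
move/piercesP => pC; have [NC|NC] := boolP ((None, None) \in C).
  rewrite (cardsD1 (None, None)) NC ltnS; apply: card_cover_split_ge.
    by rewrite !inE eqxx.
  move=> u v; have [w wC E] := pC (inl (u + v, u * v)) (in_setT _).
  exists w => //; rewrite !inE wC andbT; apply: contraPneq E => -> /=.
  by have -> : splits (u + v, u * v) by apply/splitsP; exists u, v.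
rewrite ltnNge; apply/negP => leC.
(* The q distinct cells needed on an omitted line exhaust [C], so every cell of [C] meets that
   line. *)
have meets d t v : (Some d, Some (t, 0)) \notin C -> v \in C ->
    exists a, plane_label id v.1 (inl (line_point d t a)) = v.2.
  move=> LC vC.
  have [|m inj_m mC] := injective_cover_of_line LC NC.
    by move=> a; apply: pC.
  have imC : [set m a | a in F] = C.
    apply/eqP; rewrite eqEcard card_imset // leC andbT.
    by apply/subsetP => w /imsetP[a _ ->]; case: (mC a).
  move: vC; rewrite -imC => /imsetP[a _ ->]; exists a.
  by case: (mC a).
(* A single point at infinity cannot meet both x = 0 and x = 1, so [C] contains a line. *)
have [d [t LC]] : exists d t, (Some d, Some (t, 0)) \in C.
  have [v vC _] := pC (inl (0, 0)) (in_setT _).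
  have [L0|L0] := boolP ((Some None, Some (0, 0)) \in C).
    by exists None, 0.
  have [L1|L1] := boolP ((Some None, Some (1, 0)) \in C).
    by exists None, 1.
  have [a Ea] := meets _ _ _ L0 vC; have [b Eb] := meets _ _ _ L1 vC.
  case: v vC Ea Eb => [[d|] w] /= vC Ea Eb.
    by exists d, (line_label d (0, a)); rewrite Ea.
  move: vC Eb; rewrite -{w}Ea; case: ifP => _ vC; last by rewrite vC in NC.
  case: ifP => // _ [].
  by do 2 case: ifP => _; move=> /(congr1 fst) /eqP; rewrite oner_eq0.
(* Parallel lines do not meet, so no line of direction [d] is omitted. *)
have parallel t' : (Some d, Some (t', 0)) \in C.
  apply/negPn/negP => L'; have [a] := meets _ _ _ L' LC.
  by rewrite /= line_label_point => -[E]; rewrite E LC in L'.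
pose par (t : F) : cell := (Some d, Some (t, 0)).
have inj_par : injective par by move=> x y [].
have parC : [set par t | t in F] = C.
  apply/eqP; rewrite eqEcard card_imset // leC andbT.
  by apply/subsetP => w /imsetP[a _ ->]; apply: parallel.
have [v] := pC (inr d) (in_setT _).
by rewrite -parC => /imsetP[s _ ->]; rewrite /= eqxx.
Qed.

(* Avoiding (a, 0): the large cell at infinity, the tangents other than those of
   0 and a, and, if a <> 0, the line through the two double points
   (2 a, a^2) and (0, 0). *)
Lemma axis_essential (T : {set F * F + option F}) a :
  (forall C, pierces (plane_label id) T C -> (#|F| < #|C|)%N) ->
  inl (a, 0) \in T.
Proof.
move=> tauT; apply/negPn/negP => aT.
have [d Ed] := line_label_agree (a + a, a * a) (0, 0).
pose tangent (u : F) : cell := (Some (Some u), Some (- (u * u), 0)).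
have inj_t : injective tangent by move=> u v [].
pose extra : {set cell} :=
  if a == 0 then set0 else [set (Some d, Some (line_label d (0, 0), 0))].
pose C : {set cell} := (None, None) |: ((tangent @: (~: [set 0; a])) :|: extra).
have : pierces (plane_label id) T C.
  apply/piercesP => -[e|c] pT; last by exists (None, None); rewrite // !inE.
  have [|ns] := boolP (splits e); last first.
    by exists (None, None); rewrite ?setU11 //= (negPf ns).
  case/splitsP=> u [v eE]; move: pT; rewrite {}eE => pT.
  wlog nu : u v pT / u != 0 -> u = a.
    move=> wl; have [u0a|] := boolP ((u != 0) ==> (u == a)).
      by apply: wl pT _ => u0; apply/eqP/(implyP u0a).
    rewrite negb_imply => /andP[u0 ua]; exists (tangent u).
      by rewrite !inE imset_f ?orbT // !inE negb_or u0.
    by rewrite /=; congr (Some (_, 0)); ring.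
  have [v0a|] := boolP ((v != 0) ==> (v == a)); last first.
    rewrite negb_imply => /andP[v0 va]; exists (tangent v).
      by rewrite !inE imset_f ?orbT // !inE negb_or v0.
    by rewrite /=; congr (Some (_, 0)); ring.
  have [u0|u0] := eqVneq u 0.
    have [v0|/(implyP v0a)/eqP va] := eqVneq v 0; last first.
      by rewrite u0 va add0r mul0r (negPf aT) in pT.
    have a0 : a != 0.
      apply: contraNneq aT => a0.
      by rewrite u0 v0 add0r mul0r in pT; rewrite a0.
    exists (Some d, Some (line_label d (0, 0), 0)).
      by rewrite !inE /extra (negPf a0) !inE eqxx !orbT.
    by rewrite u0 v0 /= add0r mul0r.
  have ua := nu u0.
  have [v0|/(implyP v0a)/eqP va] := eqVneq v 0.
    by rewrite ua v0 addr0 mulr0 (negPf aT) in pT.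
  exists (Some d, Some (line_label d (0, 0), 0)); rewrite /=.
    by rewrite !inE /extra -ua (negPf u0) !inE eqxx !orbT.
  by rewrite ua va /= Ed.
move/tauT; rewrite ltnNge => /negP; apply.
rewrite /C; apply: leq_trans (leq_card_setU _ _) _; rewrite cards1.
apply: leq_trans (leq_add (leqnn 1) (leq_card_setU _ _)) _.
rewrite card_imset // /extra.
(* The bound is 1 + (q - 1) if a = 0 and 1 + (q - 2) + 1 otherwise. *)
have := cardsC [set 0; a]; rewrite cards2 eq_sym.
by case: eqVneq => _ <-; rewrite ?cards0 ?cards1 ?addn0 ?addn1.
Qed.

(** * Merging cells of the row y = 0 *)

(** [phi] trades a merged cell for the line y = 0, which contains it, so merging does not lower the
    cover number. *)
Lemma pierces_plane_id g T C : pierces (plane_label g) T C ->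
  exists2 C', pierces (plane_label id) T C' & (#|C'| <= #|C|)%N.
Proof.
pose phi (v : cell) : cell :=
  if v is (None, Some (_, y)) then
    if y == 0 then (Some (Some 0), Some (0, 0)) else v
  else v.
move=> pC; exists (phi @: C); last exact: leq_imset_card.
apply: pierces_imset pC => -[[x y]|c] [[d|] w] //=; last by move<-.
case: ifP => [sp|nsp]; last by move<- => /=; rewrite nsp.
case: (eqVneq y 0) => [->|y0] <- /=; first by rewrite eqxx /= mul0r subr0.
by rewrite (negPf y0) /= sp (negPf y0).
Qed.

(** [phi] replaces a cell of the row by the merged cell containing it, so critical deletions keep
    their small covers. *)
Lemma pierces_plane_merge g T C : pierces (plane_label id) T C ->
  exists2 C', pierces (plane_label g) T C' & (#|C'| <= #|C|)%N.
Proof.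
pose phi (v : cell) : cell :=
  if v is (None, Some (x, y)) then
    if y == 0 then (None, Some (g x, 0)) else v
  else v.
move=> pC; exists (phi @: C); last exact: leq_imset_card.
apply: pierces_imset pC => -[[x y]|c] [[d|] w] //=; last by move<-.
case: ifP => [sp|nsp]; last by move<- => /=; rewrite nsp.
case: (eqVneq y 0) => [->|y0] <- /=; first by rewrite eqxx /= splits_axis eqxx.
by rewrite (negPf y0) /= sp (negPf y0).
Qed.

Definition axis_cell (u : F) : cell := (None, Some (u, 0)).

(** Only the cells [axis_cell u] feel [g]: as [T] contains the row, their degrees are the fibre
    sizes of [g]. The second summand is the same for all [g] and cancels in comparisons. *)
Lemma degree_count_plane g (T : {set F * F + option F}) j :
  (forall a, inl (a, 0) \in T) ->
  degree_count (labelled_hypergraph (plane_label g) T) j =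
  (#|[set u | #|[set a | g a == u]| == j]| +
   #|[set v : cell | (v \notin axis_cell @: F) &&
        (#|[set p in T | plane_label id v.1 p == v.2]| == j)]|)%N.
Proof.
move=> axisT; have inj_axis : injective axis_cell by move=> u v [].
rewrite /degree_count -[LHS](cardsID (axis_cell @: F)); congr (_ + _)%N.
  rewrite -(card_imset _ inj_axis); apply: eq_card => v.
  have deg_axis u :
      @degree (labelled_hypergraph (plane_label g) T) (axis_cell u) =
      #|[set a | g a == u]|.
    rewrite degree_labelled; last exact: point_edge_plane_inj.
    have inj_pt : injective (fun a : F => inl (a, 0) : F * F + option F).
      by move=> a b [].
    rewrite -[RHS](card_imset _ inj_pt); apply: eq_card => p.
    apply/setIdP/imsetP => [[pT]|[a]]; last first.
      by rewrite inE => /eqP <- ->; rewrite /= splits_axis !eqxx.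
    case: p pT => [[x y]|c] // pT /=; case: ifP => // _.
    case: (eqVneq y 0) => [->|y0] /eqP[].
      by move=> gx; exists x; rewrite // inE gx.
    by move=> _ yz; rewrite yz eqxx in y0.
  apply/setIP/imsetP => [[+ /imsetP[u _ vE]]|[u]].
    by rewrite vE inE deg_axis => du; exists u; rewrite ?inE.
  by rewrite inE => du ->; rewrite imset_f // inE deg_axis.
apply: eq_card => v; rewrite !inE; case: (boolP (v \in _)) => //= v_axis.
rewrite degree_labelled; last exact: point_edge_plane_inj.
congr (_ == j); apply: eq_card => p; rewrite !inE; congr (_ && _).
case: v v_axis => [[d|] w] //; case: p => [[x y]|c] // v_axis /=.
case: ifP => // _; case: (eqVneq y 0) => // y0.
have w_axis u : (Some (u, 0) == w) = false.
  by apply: contraNF v_axis => /eqP <-; apply: imset_f.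
by rewrite !w_axis.
Qed.

Lemma isomorphic_fibers g g' (T : {set F * F + option F}) j :
  (forall a, inl (a, 0) \in T) -> (0 < j)%N ->
  isomorphic (labelled_hypergraph (plane_label g) T)
             (labelled_hypergraph (plane_label g') T) ->
  #|[set u | #|[set a | g a == u]| == j]| =
  #|[set u | #|[set a | g' a == u]| == j]|.
Proof.
move=> axisT j_gt0 iso; have := isomorphic_degree_count iso j_gt0.
by rewrite !degree_count_plane // => /addIn.
Qed.

(** One [T], critical for [g = id], serves every [g]; this makes the degree counts comparable. *)
Lemma exists_plane_critical : exists T : {set F * F + option F},
  (forall a, inl (a, 0) \in T) /\
  forall g, minimal_intersecting_ryser #|F|.+2
              (labelled_hypergraph (plane_label g) T).
Proof.
have [T [tauT critT]] := exists_critical card_cover_plane_gt.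
have axisT a : inl (a, 0) \in T by apply: axis_essential.
exists T; split=> // g; apply: minimal_ryser_labelled.
- by rewrite !card_option.
- exact: plane_label_agree.
- exact: point_edge_plane_inj.
- by apply/set0Pn; exists (inl (0, 0)).
- by move=> C /pierces_plane_id[C' /tauT ltC]; apply: leq_trans.
- move=> p /critT[C /(pierces_plane_merge g)[C' pC' leC'] leC].
  by exists C' => //; apply: leq_trans leC.
Qed.
End Plane.

(** * Maps with prescribed fibre sizes *)

Section Blocks.

Variable n : nat.
Local Notation grid := ('I_n.+1 * 'I_n.+1)%type.

(* The columns j + 1 with j in B contribute a fibre of size j + 2 each; all
   other fibres of [block B] have at most one element. *)
Definition block (B : {set 'I_n}) (x : grid) : grid :=
  if unlift ord0 x.1 is Some i then
    if (i \in B) && (x.2 <= i.+1) then (x.1, ord0) else x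
  else x.

Lemma block_fst B x : (block B x).1 = x.1.
Proof. by rewrite /block; case: unlift => // i; case: ifP. Qed.

Lemma card_block_fiber (B : {set 'I_n}) (i : 'I_n) : i \in B ->
  #|[set x | block B x == (lift ord0 i, ord0)]| = i.+2.
Proof.
move=> iB; have lt_in : i.+2 <= n.+1 by rewrite ltnS.
pose col (k : 'I_i.+2) : grid := (lift ord0 i, widen_ord lt_in k).
have inj_col : injective col by move=> k l [] /val_inj.
rewrite -[RHS]card_ord -(card_imset _ inj_col); apply: eq_card => -[j k].
rewrite inE; apply/eqP/imsetP => [E|[l _ [-> ->]]]; last first.
  by rewrite /block liftK iB /= -ltnS ltn_ord.
have /= jE := congr1 fst E; rewrite block_fst /= in jE.
move: E; rewrite /block jE /= liftK iB /=.
have [le_k _|gt_k [] k0] := leqP k i.+1; last by rewrite k0 in gt_k.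
exists (Ordinal (le_k : k < i.+2)) => //.
by congr (_, _); apply: val_inj.
Qed.

Lemma block_fiber (B : {set 'I_n}) (i : 'I_n) :
  [exists u, #|[set x | block B x == u]| == i.+2] = (i \in B).
Proof.
apply/existsP/idP => [[[j k] /eqP cu]|iB]; last first.
  by exists (lift ord0 i, ord0); rewrite card_block_fiber.
(* If only (j, k) itself is sent to (j, k) within column j, the fibre has at most one element, too
   few for i + 2. *)
have fixed_col : ~ forall l, block B (j, l) = (j, k) -> l = k.
  move=> fix_j; have : [set x | block B x == (j, k)] \subset [set (j, k)].
    apply/subsetP => -[j' l]; rewrite !inE => /eqP E.
    have /= jE := congr1 fst E; rewrite block_fst /= in jE.
    by rewrite jE in E *; rewrite (fix_j l E).
  by move/subset_leq_card; rewrite cu cards1.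
case: (unliftP ord0 j) => [i0|] jE; last first.
  by case: fixed_col => l; rewrite /block jE unlift_none => -[].
have [i0B|i0B] := boolP (i0 \in B); last first.
  by case: fixed_col => l; rewrite /block jE /= liftK (negPf i0B) => -[].
have [k0|k0] := eqVneq k ord0; last first.
  case: fixed_col => l; rewrite /block jE /= liftK i0B /=.
  by case: ifP => _ [] // kE; rewrite kE eqxx in k0.
move: cu; rewrite jE k0 card_block_fiber // => -[] /val_inj <- //.
Qed.

End Blocks.

(** * Counting and asymptotics *)

Lemma many_minimal_ryser (F : finFieldType) (n : nat) :
  #|F| = n.+1 * n.+1 ->
  exists H : {set 'I_n} -> hypergraph,
    (forall B, minimal_intersecting_ryser #|F|.+2 (H B)) /\
    (forall B B', isomorphic (H B) (H B') -> B = B').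
Proof.
move=> cardF; have [T [axisT minT]] := exists_plane_critical F.
have cardG : #|F| = #|{: 'I_n.+1 * 'I_n.+1}| by rewrite card_prod !card_ord.
pose h (a : F) := enum_val (cast_ord cardG (enum_rank a)).
pose h' x : F := enum_val (cast_ord (esym cardG) (enum_rank x)).
have hK : cancel h h' by move=> a; rewrite /h' enum_valK cast_ordK enum_rankK.
have h'K : cancel h' h by move=> x; rewrite /h enum_valK cast_ordKV enum_rankK.
(* [block B] is carried over to [F], so that the fibre sizes of the merging map encode [B]. *)
pose g B (a : F) := h' (block B (h a)).
exists (fun B => labelled_hypergraph (plane_label (g B)) T).
split=> // B B' iso.
have fiberE (D : {set 'I_n}) (u : F) :
    #|[set a | g D a == u]| = #|[set x | block D x == h u]|.
  rewrite -(card_imset _ (can_inj h'K)); apply: eq_card => a.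
  rewrite -{2}[a]hK mem_imset ?inE; last exact: can_inj h'K.
  by rewrite /g (can2_eq h'K hK).
have memE (D : {set 'I_n}) (i : 'I_n) :
    (i \in D) = (0 < #|[set u | #|[set a | g D a == u]| == i.+2]|).
  rewrite -block_fiber; apply/existsP/card_gt0P => -[u].
    by exists (h' u); rewrite inE fiberE h'K.
  by rewrite inE fiberE; exists (h u).
by apply/setP => i; rewrite !memE (isomorphic_fibers axisT _ iso).
Qed.

Local Open Scope classical_set_scope.
Local Open Scope ring_scope.

(** With s = 2^(k+1) and r = s^2 + 2, r^(2/(k+1)) is at least 2^4 and sqrt r is at most 2 s. So the
    argument of the exponential is at most s/8, hence at most (s - 1)/2, and e^(1/2) is at most
    2. *)
Lemma exp_half_le (R : realType) (k : nat) :
  expR ((2 ^ k.+1 * 2 ^ k.+1 + 2)%:R `^ (2^-1 - 2 / k.+1%:R))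
    <= (2 ^ (2 ^ k.+1).-1)%:R :> R.
Proof.
set s := (2 ^ k.+1)%N.
have s_ge2 : (2 <= s)%N by rewrite -[2%N]expn1 leq_exp2l.
have s_ge2R : 2 <= s%:R :> R by rewrite ler_nat.
have rE : (s * s + 2)%:R = s%:R * s%:R + 2 :> R by rewrite natrD natrM.
set x : R := (s * s + 2)%:R `^ _.
suff le_x : x <= s.-1%:R * 2^-1.
  apply: (@le_trans _ _ (expR (2^-1) ^+ s.-1)).
    by rewrite -expRM_natl ler_expR.
  rewrite natrX lerXn2r ?nnegrE ?expR_ge0 //.
  (* Passing to inverses, e^(-1/2) is at least 1 - 1/2. *)
  rewrite -[expR _]invrK -expRN -[leRHS]invrK lef_pV2 ?posrE ?expR_gt0 //.
  by apply: le_trans (expR_ge1Dx _); lra.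
have r_gt0 : 0 < (s * s + 2)%:R :> R by rewrite ltr0n addn2.
have xE : x = Num.sqrt (s * s + 2)%:R / (s * s + 2)%:R `^ (2 / k.+1%:R).
  rewrite /x powRB; first by rewrite powR12_sqrt ?ltW.
  by apply/implyP => _; rewrite gt_eqF.
have den_ge : 16 <= (s * s + 2)%:R `^ (2 / k.+1%:R) :> R.
  have -> : 16 = (s%:R * s%:R) `^ (2 / k.+1%:R) :> R.
    rewrite /s natrX -exprD -powR_mulrn // -powRrM.
    have -> : (k.+1 + k.+1)%:R * (2 / k.+1%:R) = 4%:R :> R.
      have : k.+1%:R != 0 :> R by rewrite pnatr_eq0.
      by rewrite natrD; move: k.+1%:R => z z_n0; field.
    by rewrite powR_mulrn //; ring.
  apply: ge0_ler_powR; rewrite ?nnegrE ?divr_ge0 ?mulr_ge0 ?ler0n //.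
  by rewrite rE; lra.
have num_le : Num.sqrt (s * s + 2)%:R <= 2 * s%:R :> R.
  rewrite -[leRHS]ger0_norm; last by lra.
  by rewrite -sqrtr_sqr ler_wsqrtr // rE expr2; nra.
have s1E : s.-1%:R = s%:R - 1 :> R.
  by rewrite -subn1 natrB // (leq_trans _ s_ge2).
rewrite xE s1E ler_pdivrMr; last by apply: lt_le_trans den_ge; lra.
apply: le_trans num_le _.
apply: (@le_trans _ _ ((s%:R - 1) / 2 * 16)); first by lra.
by apply: ler_wpM2l => //; lra.
Qed.

Theorem theorem1p5 (R : realType) :
  exists (r : nat -> nat) (eps : nat -> R),
    [/\ forall k l : nat, (k < l)%N -> (r k < r l)%N,
        eps k @[k --> \oo] --> (0 : R) &
        forall k : nat,
          exists (m : nat) (H : 'I_m -> hypergraph),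
            [/\ expR ((r k)%:R `^ (2^-1 - eps k)) <= m%:R :> R,
                forall i : 'I_m, minimal_intersecting_ryser (r k) (H i) &
                forall i j : 'I_m, i != j -> ~ isomorphic (H i) (H j)]].
Proof.
exists (fun k => (2 ^ k.+1 * 2 ^ k.+1 + 2)%N), (fun k => 2 / k.+1%:R); split.
- by move=> k l lt_kl; rewrite ltn_add2r ltn_mul // ltn_exp2l.
- rewrite -[X in _ --> X](mulr0 (2 : R)); apply: cvgM; first exact: cvg_cst.
  exact: cvg_harmonic.
move=> k; pose n := (2 ^ k.+1).-1.
have nE : n.+1 = (2 ^ k.+1)%N by rewrite prednK // expn_gt0.
(* The doubled exponent makes the order of [F] a square, as the bijection with the grid requires. *)
have [F _ cardF] := @pPrimePowerField 2 (k.+1 + k.+1) isT isT.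
have cardF' : #|F| = (n.+1 * n.+1)%N by rewrite cardF nE expnD.
have [H [minH isoH]] := many_minimal_ryser cardF'.
exists #|{set 'I_n}|, (fun i => H (enum_val i)); split.
- rewrite -cardsT -powersetT card_powerset cardsT card_ord.
  exact: exp_half_le.
- by move=> i; rewrite -nE -cardF' addn2; apply: minH.
- by move=> i j ij /isoH /enum_val_inj E; rewrite E eqxx in ij.
Qed.
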